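(* Let $\kappa$ be an infinite cardinal. The forcing poset $\mathbb{P}_\kappa$ is $(\kappa+1)$-strategically closed.
   Context: $\mathbb{S}_\kappa$ is the set of all $t:\gamma+1\to\omega$ with $\gamma<\kappa^+$ such that: (a) for each integer $n\ge-1$, $C^t_n:=\{\beta<\gamma+1:t(\beta)\le n\}$ is closed; (b) for each limit $\beta\le\gamma$, $t(\beta)$ is the least $n$ such that $C^t_n$ is unbounded in $\beta$; (c) for each $n$, if $I$ is a maximal open interval of $\gamma+1$ disjoint from $C^t_{n-1}$, then $\mathrm{otp}(C^t_n\cap I)<\kappa\cdot\omega$. A $\varrho_2$-modifier is a function $m:\kappa^+\to\mathbb{Z}$ which is continuous (for each limit $\beta<\kappa^+$ it is constant on $[\eta,\beta]$ for some $\eta<\beta$) and eventually constant; it is legal for $s\in\mathbb{S}_\kappa$ if $s+m$ (coordinatewise sum on the domain of $s$) has nonnegative values. For $s\in\mathbb{S}_\kappa$, $[s]$ is the set of all $s+m$ with $m$ legal for $s$. $\mathbb{P}_\kappa=\{[s]:s\in\mathbb{S}_\kappa\}$, ordered by $[t]\le[s]$ iff $|s|\le|t|$ and $[s]=[t\restriction|s|]$; it is taken to have a maximum element $1$ (the class of the empty sequence) above all conditions. For an ordinal $\alpha$, the game $G_\alpha(\mathbb{P})$ has players Odd and Even alternately playing conditions $p_\beta$ for $\beta<\alpha$; Even plays at even stages (including $0$ and all limit stages) and Odd at odd stages; Even must play $1$ at move $0$; the player who plays $p_\beta$ loses immediately unless $p_\beta\le p_\gamma$ for all $\gamma<\beta$;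 if no one loses at any stage $\beta<\alpha$, Even wins. $\mathbb{P}$ is $\gamma$-strategically closed if Even has a winning strategy in $G_\gamma(\mathbb{P})$. *)

(* Defs.v *)
From HB Require Import structures.
From mathcomp Require Import all_boot all_order all_algebra.
From mathcomp Require Import all_classical.
From mathcomp Require wochoice.

Set Implicit Arguments.
Unset Strict Implicit.
Unset Printing Implicit Defensive.

Import Order.Theory.

Local Open Scope card_scope.
Local Open Scope order_scope.
Local Open Scope classical_set_scope.

(* The ordinals under consideration are the elements of a well-ordered type O.
   As with von Neumann ordinals, an ordinal is also viewed as the set of the
   smaller ones, i.e. as an initial segment of O; an initial segment can be an
   ordinal (such as 0, or gamma + 1) whose own index in O is never needed. *)
Section Ordinals.
Context {d : Order.disp_t} {O : orderType d}.
Implicit Types (a b g : O) (A C : set O).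

Definition well_ordered : Prop := wochoice.well_order (<=%O : rel O).

Definition below b : set O := [set x | x < b].

(* the ordinal g + 1 *)
Definition succ g : set O := [set x | x <= g].

Definition is_zero b : Prop := forall x, b <= x.

Definition is_succ a b : Prop := a < b /\ forall x, x < b -> x <= a.

Definition is_limit b : Prop := ~ is_zero b /\ forall a, ~ is_succ a b.

Inductive even_stage : O -> Prop :=
  | even_zero b : is_zero b -> even_stage b
  | even_limit b : is_limit b -> even_stage b
  | even_succ a b : is_succ a b -> odd_stage a -> even_stage b
with odd_stage : O -> Prop :=
  | odd_succ a b : is_succ a b -> even_stage a -> odd_stage b.

(* infinite cardinals are the infinite initial ordinals *)
Definition infinite_cardinal (k : O) : Prop :=
  infinite_set (below k) /\ forall b, b < k -> ~ (below b #= below k).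

(* the order type of O is k^+, the least ordinal that does not inject into k *)
Definition order_type_is_succ_cardinal (k : O) : Prop :=
  ~ ([set: O] #<= below k) /\ forall g, below g #<= below k.

Definition unbounded_in C b : Prop :=
  forall a, a < b -> exists x, [/\ C x, a <= x & x < b].

(* closedness in the order topology of g + 1, for C included in g + 1 *)
Definition closed_in_succ g C : Prop :=
  forall b, b <= g -> is_limit b -> unbounded_in C b -> C b.

(* The open intervals of g + 1 are the traces on g + 1 of the open intervals of
   O, rays included. *)
Definition open_interval_of_succ g (I : set O) : Prop :=
  exists2 i : interval O, itv_open_ends i & I = succ g `&` [set` i].

Definition maximal_open_interval_avoiding g C (I : set O) : Prop :=
  [/\ open_interval_of_succ g I, I `&` C = set0 &
      forall J, open_interval_of_succ g J -> J `&` C = set0 ->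
        I `<=` J -> J = I].

End Ordinals.

(* otp A < otp B, for sets A and B well-ordered by the ambient orders *)
Definition otp_lt d d' (T : orderType d) (U : orderType d')
    (A : set T) (B : set U) : Prop :=
  exists2 y, B y & exists f : T -> U,
    (forall x x', A x -> A x' -> x < x' -> f x < f x') /\
    f @` A = [set z | B z /\ z < y].

(* The ordinal product k * omega, i.e. omega copies of k one after the other. *)
Definition mul_omega d (O : orderType d) (k : O) : set (nat *l O)%type :=
  [set p | p.2 < k].

Section Poset.
Context {d : Order.disp_t} {O : orderType d}.

(* Transfinite sequences of natural numbers are partial functions; |s| is the
   domain of s. *)
Definition oseq : Type := O -> option nat.

Implicit Types (s t : oseq) (m : O -> int) (k : O).

Definition len s : set O := [set b | s b <> None].

Definition restrict t (A : set O) : oseq :=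
  fun b => if `[< A b >] then t b else None.

Definition empty_seq : oseq := fun=> None.

(* the set C^t_n *)
Definition Cset t (n : int) : set O :=
  [set b | exists2 v : nat, t b = Some v & (v%:Z <= n)%R].

Definition Skappa k t : Prop :=
  exists g : O, [/\ len t = succ g,
    (forall n : int, (-1 <= n)%R -> closed_in_succ g (Cset t n)),
    (forall b, is_limit b -> b <= g -> forall v : nat, t b = Some v ->
       unbounded_in (Cset t v%:Z) b /\
       forall n : int, unbounded_in (Cset t n) b -> (v%:Z <= n)%R)
  & (forall (n : nat) (I : set O),
       maximal_open_interval_avoiding g (Cset t (n%:Z - 1)%R) I ->
       otp_lt (Cset t n%:Z `&` I) (mul_omega k))].

Definition modifier m : Prop :=
  (forall b, is_limit b ->
     exists2 a, a < b & forall x, a <= x -> x <= b -> m x = m b) /\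
  (exists a, forall x, a <= x -> m x = m a).

(* the coordinatewise sum s + m, with integer values, on the domain of s *)
Definition add_modifier s m : O -> option int :=
  fun b => if s b is Some v then Some (v%:Z + m b)%R else None.

Definition legal m s : Prop :=
  forall b z, add_modifier s m b = Some z -> (0 <= z)%R.

(* the class [s] *)
Definition class_of s : set oseq :=
  [set t | exists m, [/\ modifier m, legal m s &
     (fun b => omap Posz (t b)) = add_modifier s m]].

(* the sequences representing a condition: the empty one represents 1 *)
Definition representative k s : Prop := Skappa k s \/ s = empty_seq.

Definition Pkappa k : Type :=
  {p : set oseq | exists2 s, representative k s & p = class_of s}.

Definition Pkappa_le k (p q : Pkappa k) : Prop :=
  exists t s, [/\ representative k t /\ sval p = class_of t,
    representative k s /\ sval q = class_of s, len s `<=` len t &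
    class_of s = class_of (restrict t (len s))].

Lemma class_empty_proof k :
  exists2 s, representative k s & class_of empty_seq = class_of s.
Proof. by exists empty_seq => //; right. Qed.

Definition Pkappa_one k : Pkappa k := exist _ (class_of empty_seq) (class_empty_proof k).

End Poset.

(* The game G_alpha(P), where alpha is given as an initial segment of O. *)
Section Game.
Context {d : Order.disp_t} {O : orderType d}.
Context {P : Type} (le : P -> P -> Prop) (one : P).
Implicit Types (alpha : set O) (p : O -> P).

(* the values of p outside of alpha are irrelevant *)
Definition acceptable_move p (b : O) : Prop :=
  (forall g, g < b -> le (p b) (p g)) /\ (is_zero b -> p b = one).

Definition loss_at p (b : O) : Prop :=
  (forall g, g < b -> acceptable_move p g) /\ ~ acceptable_move p b.

(* Even wins iff Even does not lose at any stage: either Odd does, or no one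
   does. *)
Definition Even_wins alpha p : Prop :=
  forall b, alpha b -> even_stage b -> ~ loss_at p b.

Definition strategy : Type := forall b : O, ({g : O | g < b} -> P) -> P.

Definition follows alpha (sigma : strategy) p : Prop :=
  forall b, alpha b -> even_stage b -> p b = sigma b (fun g => p (sval g)).

Definition strategically_closed alpha : Prop :=
  exists sigma : strategy, forall p, follows alpha sigma p -> Even_wins alpha p.

End Game.

(* Main.v *)
From mathcomp Require Import all_boot all_order all_algebra.
From mathcomp Require Import all_classical.
From mathcomp Require Import zify.
From mathcomp Require wochoice.
Require Import Defs.

(* Even maintains a representative T_b of each of his moves p_b, the T_b being
   increasing under end extension, each T_b with b > 0 ending with the value 0.
   When Odd answers p_b by a class [s], the part of s above dom T_b can be
   shifted by any constant, since a modifier may be changed arbitrarily after a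
   successor length.  So Even takes T_b, followed by s + 1 on the rest of dom s,
   followed by a single 0.  At limits he takes the union of the previous T_b
   followed by 0, which is the right value because zeros are cofinal; the
   length is still below kappa^+ by regularity of kappa^+.
   Clause (c) for n > 0 only concerns intervals without zeros, hence it is
   inherited from a previous T_b or from clause (c) of s for n - 1.  For n = 0
   it holds because the zeros of T_b are among the last points of the T_c with
   c <= b <= kappa, so there are at most kappa + 1 of them. *)

Set Implicit Arguments.
Unset Strict Implicit.
Unset Printing Implicit Defensive.

Import Order.Theory.

Local Open Scope card_scope.
Local Open Scope order_scope.
Local Open Scope classical_set_scope.

(** * Well-orders and cardinals *)

Section WellOrder.
Context {d : Order.disp_t} {T : orderType d}.
Hypothesis wo : well_ordered (O := T).

Lemma wo_min (A : set T) : A !=set0 -> exists2 z, A z & forall x, A x -> z <= x.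
Proof.
move=> [x Ax]; have [|z [[/asboolP Az minz] _]] := wo (A := [pred x | `[< A x >]]).
  by exists x; apply/asboolP.
by exists z => // y Ay; apply: minz; apply/asboolP.
Qed.

Lemma wo_wf : well_founded (fun x y : T => x < y).
Proof.
move=> x; apply: contrapT => nx.
have [|z nz minz] := @wo_min [set y | ~ Acc (fun x y : T => x < y) y].
  by exists x.
apply: nz; constructor => y yz; apply: contrapT => /minz.
by rewrite leNgt yz.
Qed.

Lemma wo_ind (P : T -> Prop) :
  (forall x, (forall y, y < x -> P y) -> P x) -> forall x, P x.
Proof. by move=> ? x; elim/(well_founded_ind wo_wf): x. Qed.

End WellOrder.

Lemma well_ordered_of_min d (T : orderType d) :
  (forall A : set T, A !=set0 -> exists2 z, A z & forall x, A x -> z <= x) ->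
  well_ordered (O := T).
Proof.
move=> minT; apply: wochoice.antisymmetric_well_order => [|A [x Ax]].
  by move=> x y; apply: le_anti.
by have [|z Az minz] := minT (fun x => x \in A); [exists x | exists z].
Qed.

Lemma nat_well_ordered : well_ordered (O := nat).
Proof.
apply: well_ordered_of_min => A [n An].
have exA : exists n, `[< A n >] by exists n; apply/asboolP.
case: (ex_minnP exA) => m /asboolP Am minm; exists m => // x Ax.
by rewrite leEnat; apply: minm; apply/asboolP.
Qed.

Lemma lexi_well_ordered d d' (T : orderType d) (U : orderType d') :
  well_ordered (O := T) -> well_ordered (O := U) -> well_ordered (O := (T *l U)%type).
Proof.
move=> woT woU; apply: well_ordered_of_min => A [[x y] Axy].
have [|a [b Aab] mina] := wo_min woT (A := [set a | exists b, A (a, b)]).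
  by exists x, y.
have [|c Aac minc] := wo_min woU (A := [set c | A (a, c)]); first by exists b.
exists (a, c) => // -[u v] Auv; rewrite leEprodlexi /=.
have au : a <= u by apply: mina; exists v.
rewrite au /=; apply/implyP => ua; apply: minc => /=.
by rewrite (le_anti (x := a) (y := u)) // au ua.
Qed.

Section Greedy.
Context {d d' : Order.disp_t} {T : orderType d} {U : orderType d'}.
Hypothesis woT : well_ordered (O := T).
Hypothesis woU : well_ordered (O := U).

(** Recursion along [T]: [g x] is the least element of [B] not yet used by points of [A] below [x].
    The premise on [x] says that one is left; otherwise [g x] takes the default [u0]. *)
Lemma greedy_map (A : set T) (B : set U) (u0 : U) :
  exists g : T -> U, forall x,
    (exists2 z, B z & forall x', A x' -> x' < x -> g x' <> z) ->
    [/\ B (g x), forall x', A x' -> x' < x -> g x' <> g x &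
      forall z, B z -> (forall x', A x' -> x' < x -> g x' <> z) -> g x <= z].
Proof.
pose S x (h : forall x', x' < x -> U) : set U :=
  [set z | B z /\ forall x' (lt : x' < x), A x' -> h x' lt <> z].
pose F x h := xget u0 [set z | S x h z /\ forall z', S x h z' -> z <= z'].
pose g := Fix (wo_wf woT) (fun=> U) F.
have gE x : g x = F x (fun x' _ => g x').
  rewrite /g Fix_eq // => y f h fh; congr (F y _).
  by apply: functional_extensionality_dep => z; apply: functional_extensionality_dep.
exists g => x [z Bz gz].
have [|m Sm minm] := wo_min woU (A := S x (fun x' _ => g x')).
  by exists z; split=> // x' lt Ax'; apply: gz.
have := @xgetI _ u0 [set z | S x (fun x' _ => g x') z /\
   forall z', S x (fun x' _ => g x') z' -> z <= z'] m (conj Sm minm).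
rewrite -/(F x _) -gE => -[[Bg gne] ming]; split=> // [x' Ax' lt|z' Bz' gz'].
  exact: gne.
by apply: ming; split=> // x' lt Ax'; apply: gz'.
Qed.

(* A strictly increasing map is turned into one onto an initial segment by
   sending each point to the first value not taken before. *)
Lemma otp_lt_of_increasing (A : set T) (B : set U) (f : T -> U) (y : U) :
  B y -> (forall x, A x -> B (f x) /\ f x < y) ->
  (forall x x', A x -> A x' -> x < x' -> f x < f x') -> otp_lt A B.
Proof.
move=> By fB fI; have [g gP] := greedy_map A B y.
(* By induction the earlier values of [g] lie below [f x], so [f x] is still free at [x]. *)
have gf x : A x -> g x <= f x.
  elim/(wo_ind woT): x => x IH Ax.
  have ne x' : A x' -> x' < x -> g x' <> f x.
    move=> Ax' lt e; have := le_lt_trans (IH _ lt Ax') (fI _ _ Ax' Ax lt).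
    by rewrite e ltxx.
  have [|_ _] := gP x; first by exists (f x) => //; case: (fB x Ax).
  by apply=> //; case: (fB x Ax).
have gA x : A x -> [/\ B (g x), forall x', A x' -> x' < x -> g x' < g x &
      forall z, B z -> z < g x -> exists2 x', A x' & g x' = z].
  move=> Ax; have [|Bg gne gmin] := gP x.
    exists (f x) => [|x' Ax' lt e]; first by case: (fB x Ax).
    have := le_lt_trans (gf _ Ax') (fI _ _ Ax' Ax lt).
    by rewrite e ltxx.
  split=> // [x' Ax' lt|z Bz lt].
    have [|_ _ gmin'] := gP x'.
      exists (f x') => [|x'' Ax'' lt' e]; first by case: (fB x' Ax').
      have := le_lt_trans (gf _ Ax'') (fI _ _ Ax'' Ax' lt').
      by rewrite e ltxx.
    rewrite lt_neqAle; apply/andP; split; first by apply/eqP; apply: gne.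
    by apply: gmin' => // x'' Ax'' lt'; apply: gne => //; apply: lt_trans lt' lt.
  apply: contrapT => nex.
  have /gmin : B z by [].
  rewrite leNgt lt => H; suff: ~~ true by []; apply: H => x' Ax' _ e.
  by apply: nex; exists x'.
(* The image of [g] is the segment below the first value [m] that it misses; [y] is missed because
   [g x <= f x < y]. *)
have [|m [Bm gm] minm] := wo_min woU (A := [set z | B z /\ forall x, A x -> g x <> z]).
  exists y; split=> // x Ax e; case: (fB x Ax) => _.
  by rewrite ltNge -e gf.
exists m => //; exists g; split=> [x x' Ax Ax' lt|].
  by have [_ + _] := gA x' Ax'; apply.
apply/seteqP; split=> [_ [x Ax <-]|z [Bz lt]] /=.
  have [Bg _ gi] := gA x Ax; split=> //.
  rewrite ltNge; apply/negP; rewrite le_eqVlt => /orP[/eqP e|/(gi _ Bm)[x' Ax' e]].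
    by apply: (gm x).
  by apply: (gm x').
apply: contrapT => nex; have := minm z; rewrite leNgt lt => H; suff: ~~ true by []; apply: H.
by split=> // x Ax e; apply: nex; exists x.
Qed.

End Greedy.

(** * Cardinal arithmetic and regularity of kappa^+ *)

Section Cardinals.
Context {d : Order.disp_t} {O : orderType d}.
Hypothesis wo : well_ordered (O := O).

Lemma card_leW (T U : Type) (A : set T) (B : set U) (f : T -> U) :
  (forall x, A x -> B (f x)) ->
  (forall x x', A x -> A x' -> f x = f x' -> x = x') -> A #<= B.
Proof.
move=> fB fI; have [f'] : $|{injfun A >-> B}|.
  by apply/injfunPex; exists f => [x Ax|x x' /set_mem Ax /set_mem Ax']; [apply: fB|apply: fI].
exact: inj_card_le f'.
Qed.

Lemma card_le_inj (T U : Type) (A : set T) (B : set U) (u0 : U) : A #<= B ->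
  exists f : T -> U, (forall x, A x -> B (f x)) /\
  (forall x x', A x -> A x' -> f x = f x' -> x = x').
Proof.
move=> /card_leP[f]; pose f' x := if pselect (A x) is left Ax
  then \val (f (SigSub (mem_set Ax))) else u0.
exists f'; split=> [x Ax|x x' Ax Ax'].
  by rewrite /f'; case: pselect => // ?; apply: set_valP.
rewrite /f'; case: pselect => // {}Ax; case: pselect => // {}Ax' /val_inj.
by move=> /(@inj _ _ _ f) e; have /(congr1 val) := e (mem_set I) (mem_set I).
Qed.

Lemma card_le_setX (T T' U U' : Type) (u0 : U) (u0' : U')
    (A : set T) (A' : set T') (B : set U) (B' : set U') :
  A #<= B -> A' #<= B' -> A `*` A' #<= B `*` B'.
Proof.
move=> /(card_le_inj u0)[f [fB fI]] /(card_le_inj u0')[f' [fB' fI']].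
apply: (card_leW (f := fun p => (f p.1, f' p.2))) => [[x x'] [] /=|[x x'] [y y']].
  by split; [apply: fB|apply: fB'].
by move=> [/= Ax Ax'] [/= Ay Ay'] [/fI-> // /fI'->].
Qed.

(** The points below [g] and the point [g] itself are sent to pairs with different first
    coordinates. The bound on the square of [l] is a premise because this is also used inside the
    induction that proves it. *)
Lemma succ_card_le (g l : O) : infinite_set (below l) ->
  below l `*` below l #<= below l -> below g #<= below l -> succ g #<= below l.
Proof.
move=> inf ll gl; apply: card_le_trans ll.
have [a al [b bl ab]] : exists2 a, a < l & exists2 b, b < l & a <> b.
  have [a al] := infinite_setN0 inf; exists a => //; apply: contrapT => nb.
  apply: inf; apply: sub_finite_set (finite_set1 a) => b bl /=.
  by apply: contrapT => ba; apply: nb; exists b => // ab; apply: ba.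
have [f [fB fI]] := card_le_inj g gl.
apply: (card_leW (f := fun x => if x < g then (a, f x) else (b, a))).
  by move=> x _ /=; case: ifP => // lt; split=> //; apply: fB.
move=> x y xg yg; case: ifP => xlt; case: ifP => ylt.
- by move=> [] /fI; apply.
- by move=> [].
- by move=> [/esym].
move=> _; have e' z : z <= g -> (z < g) = false -> z = g.
  by rewrite le_eqVlt => /orP[/eqP //|->].
by rewrite (e' x) // (e' y).
Qed.

(* Goedel's ordering of pairs: by the maximum first, so that the predecessors
   of a pair with maximum m lie in (m + 1) * (m + 1). *)
Lemma infinite_square_le (l : O) : infinite_set (below l) ->
  below l `*` below l #<= below l.
Proof.
elim/(wo_ind wo): l => l IH inf.
(* If [l] has the size of some [m < l], the induction hypothesis for [m] transfers to [l].
   Afterwards [l] is initial. *)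
have [[m ml ml']|init] := pselect (exists2 m, m < l & below m #= below l).
  have [ml1 ml2] : below m #<= below l /\ below l #<= below m.
    by apply/andP; rewrite -card_eq_le.
  have minf : infinite_set (below m) by move=> /(card_le_finite ml2).
  apply: card_le_trans ml1; apply: card_le_trans (IH _ ml minf).
  exact: card_le_setX.
pose A : set (O *l (O *l O))%type :=
  [set x | x.2.1 < l /\ x.2.2 < l /\ x.1 = Order.max x.2.1 x.2.2].
have woX := lexi_well_ordered wo (lexi_well_ordered wo wo).
have [g gP] := greedy_map woX wo A (below l) l.
(* The values below [l] never run out: otherwise [l] would inject into the square of [m + 1], where
   [m < l] is the maximum of the pair. For infinite [m] this contradicts that [l] is initial, for
   finite [m] that it is infinite. *)
have key x : A x -> exists2 z, below l z & forall x', A x' -> x' < x -> g x' <> z.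
  move=> [x1 [x2 x0]]; apply: contrapT => nz.
  set m := x.1 in x0; have ml : m < l by rewrite x0; case: (leP x.2.1 x.2.2).
  pose P := [set x' | A x' /\ x' < x].
  have lP : below l #<= P.
    apply: card_le_trans (card_image_le g P); apply: subset_card_le => z zl.
    apply: contrapT => nz'; apply: nz; exists z => // x' Ax' lt e; apply: nz'.
    by exists x'.
  have PX : P #<= succ m `*` succ m.
    apply: (card_leW (f := fun x : (O *l (O *l O))%type => (x.2.1, x.2.2))).
      move=> x' [[_ [_ e]]]; rewrite ltEprodlexi => /andP[le _].
      have := le; rewrite e => /(le_trans _) H.
      by split; apply: H; rewrite le_max lexx ?orbT.
    move=> [a [b c]] [a' [b' c']] [[_ [_ /= e]] _] [[_ [_ /= e']] _] [eb ec].
    by rewrite e e' eb ec.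
  have lm := card_le_trans lP PX.
  have [minf|mfin] := pselect (infinite_set (below m)).
    have sm : succ m #<= below m := succ_card_le minf (IH m ml minf) (card_lexx _).
    apply: init; exists m => //; rewrite card_eq_le; apply/andP; split.
      by apply: subset_card_le => z /= zm; apply: lt_trans ml.
    apply: card_le_trans lm _; apply: card_le_trans (IH m ml minf).
    exact: card_le_setX.
  apply: inf; apply: card_le_finite lm _; move/contrapT: mfin => mfin.
  have smf : finite_set (succ m).
    apply: (@sub_finite_set _ _ (below m `|` [set m])) => [z|].
      by rewrite /succ /= le_eqVlt => /orP[/eqP->|]; [right|left].
    by rewrite finite_setU; split; [exact: mfin|exact: finite_set1].
  exact: finite_setX.
apply: (card_leW (f := fun p => g (Order.max p.1 p.2, (p.1, p.2)))) => [[a b] [/= al bl]|].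
  by case: (gP (Order.max a b, (a, b))); first exact: key.
move=> [a b] [a' b'] [/= al bl] [/= al' bl'].
set x : (O *l (O *l O))%type := (_, _); set x' : (O *l (O *l O))%type := (_, _).
have Ax : A x by []. have Ax' : A x' by [].
have [lt|lt|] := ltgtP x x'; last by case=> _ -> ->.
  by have [|_ /(_ _ Ax lt) ne _ /ne] := gP x'; first exact: key.
by have [|_ /(_ _ Ax' lt) ne _ /esym/ne] := gP x; first exact: key.
Qed.

(** This is the regularity of kappa^+. If [f] were cofinal on [k], each [y] would be determined by
    some [h y < k] with [y <= f (h y)] and by its code under an injection of [succ (f (h y))] into
    [k], so [O] would inject into the square of [k], hence into [k]. *)
Lemma bounded_of_succ_cardinal (k : O) (f : O -> O) :
  infinite_set (below k) -> order_type_is_succ_cardinal k ->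
  exists y, forall x, x < k -> f x < y.
Proof.
move=> inf [nO gO]; apply: contrapT => nb; apply: nO.
have cof y : exists x, x < k /\ y <= f x.
  apply: contrapT => ny; apply: nb; exists y => x xk.
  by rewrite ltNge; apply/negP => yf; apply: ny; exists x.
have [h hP] := choice cof; have kk := infinite_square_le inf.
have /choice[e eP] x := card_le_inj x (succ_card_le inf kk (gO (f x))).
apply: card_le_trans kk.
apply: (card_leW (f := fun y => (h y, e (h y) y))) => [y _|y z _ _].
  by split; [case: (hP y)|case: (eP (h y)) => + _; apply; case: (hP y)].
move=> [hh]; rewrite hh; case: (eP (h z)) => _; apply.
  by rewrite /succ /= -hh; case: (hP y).
by case: (hP z).
Qed.

End Cardinals.

(** * Sequences with small order types *)

Section Sequences.
Context {d : Order.disp_t} {O : orderType d}.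
Hypothesis wo : well_ordered (O := O).
Local Notation oseq := (@oseq d O).
Variable k : O.
Hypothesis k_infinite : infinite_set (below k).

(* Equivalent to otp A < k * omega, but the embedding need not be onto an
   initial segment. *)
Definition small (A : set O) : Prop :=
  exists (N : nat) (f : O -> (nat *l O)%type),
    (forall x, A x -> ((f x).1 <= N)%N /\ (f x).2 < k) /\
    (forall x x', A x -> A x' -> x < x' -> f x < f x').

Lemma small_otp A : small A -> otp_lt A (mul_omega k).
Proof.
move=> [N [f [fN fI]]]; have [z zk] := infinite_setN0 k_infinite.
apply: (otp_lt_of_increasing wo (lexi_well_ordered nat_well_ordered wo)
  (f := f) (y := (N.+1, z))) => // x Ax.
have [le lt] := fN x Ax; split=> //.
by rewrite ltEprodlexi /= !leEnat (leqW le) /= ltnNge le.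
Qed.

Lemma otp_small A : otp_lt A (mul_omega k) -> small A.
Proof.
move=> [[N z] _ [f [fI fA]]]; exists N, f; split=> // x Ax.
have [fk] : [set z' | mul_omega k z' /\ z' < ((N, z) : (nat *l O)%type)] (f x).
  by rewrite -fA; exists x.
by rewrite ltEprodlexi /= leEnat => /andP[le _]; split.
Qed.

Lemma small_sub A B : A `<=` B -> small B -> small A.
Proof.
move=> AB [N [f [fN fI]]]; exists N, f; split=> [x /AB/fN //|x x' /AB Bx /AB].
exact: fI.
Qed.

Lemma small0 : small set0.
Proof. by exists 0%N, (fun x => (0%N, x)). Qed.

Definition order_convex (I : set O) : Prop :=
  forall x y z, I x -> I z -> x <= y -> y <= z -> I y.

(** Clause (c) for convex sets instead of maximal open intervals: those intervals change when a
    sequence is extended, whereas a convex set can be carried from one sequence to another. *)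
Definition convex_small (t : oseq) : Prop :=
  forall (n : nat) (I : set O), order_convex I -> I `<=` len t ->
    I `&` Cset t (n%:Z - 1)%R = set0 -> small (Cset t n%:Z `&` I).

Lemma len_le (t : oseq) g x v : len t = succ g -> t x = Some v -> x <= g.
Proof.
by move=> tg tv; suff: succ g x by []; rewrite -tg /len /= tv.
Qed.

Lemma open_interval_order_convex g (I : set O) : open_interval_of_succ g I -> order_convex I.
Proof.
move=> [[l r] _ ->] x y z [gx xI] [gz zI] xy yz; split; first exact: le_trans gz.
move: xI zI; rewrite /= !itv_boundlr => /andP[lx _] /andP[_ zr].
by rewrite (le_trans lx) ?(le_trans _ zr).
Qed.

(** The left end is the supremum [a] of the points of [C] below [x0], if there are any. Closedness
    puts [a] in [C], so [a] differs from [x0] and [x0] lies in the open ray above [a]. *)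
Lemma left_end g (C : set O) (x0 : O) : closed_in_succ g C -> x0 <= g -> ~ C x0 ->
  exists2 l : itv_bound O, l = -oo%O \/ (exists a, l = BRight a) &
    forall y, l <= BLeft y <-> (forall c, C c -> c < x0 -> c < y).
Proof.
move=> Ccl x0g nC.
have [[c [Cc cx]]|nc] := pselect (exists c, C c /\ c < x0); last first.
  exists -oo%O; first by left.
  by move=> y; split=> // _ c Cc cx; case: nc; exists c.
have [|a aub amin] := wo_min wo (A := [set a | forall c, C c -> c < x0 -> c <= a]).
  by exists x0 => c' _ /ltW.
have ax : a <= x0 by apply: amin => c' _ /ltW.
have Ca : C a.
  apply: contrapT => nCa.
  have lta c' : C c' -> c' < x0 -> c' < a.
    move=> Cc' lt; rewrite lt_neqAle aub // andbT.
    by apply/eqP => e; rewrite -e in nCa.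
  apply: nCa; apply: Ccl; first exact: le_trans x0g.
    split=> [/(_ c)|b [ba bs]]; first by rewrite leNgt lta.
    have /amin : forall c', C c' -> c' < x0 -> c' <= b.
      by move=> c' Cc' lt; apply: bs; apply: lta.
    by rewrite leNgt ba.
  move=> z za; apply: contrapT => nz.
  have /amin : forall c', C c' -> c' < x0 -> c' <= z.
    move=> c' Cc' lt; rewrite leNgt; apply/negP => zc; apply: nz; exists c'.
    by split=> //; [apply: ltW|apply: lta].
  by rewrite leNgt za.
have ax0 : a < x0 by rewrite lt_neqAle ax andbT; apply/eqP => e; rewrite -e in nC.
exists (BRight a); first by right; exists a.
move=> y; split=> [ay c' Cc' lt|]; last by move=> /(_ a Ca ax0).
by apply: le_lt_trans (aub _ Cc' lt) _.
Qed.

Lemma right_end (C : set O) (x0 : O) :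
  exists2 r : itv_bound O, r = +oo%O \/ (exists b, r = BLeft b) &
    forall y, BRight y <= r <-> (forall c, C c -> x0 < c -> y < c).
Proof.
have [[c [Cc cx]]|nc] := pselect (exists c, C c /\ x0 < c); last first.
  exists +oo%O; first by left.
  by move=> y; split=> // _ c Cc cx; case: nc; exists c.
have [|b [Cb xb] bmin] := wo_min wo (A := [set b | C b /\ x0 < b]).
  by exists c.
exists (BLeft b); first by right; exists b.
move=> y; split=> [yb c' Cc' lt|]; last by move=> /(_ b Cb xb).
by apply: lt_le_trans (bmin c' _).
Qed.

(* A convex set avoiding the closed set C^t_(n-1) is included in a maximal open
   interval avoiding it, so clause (c) extends to all such convex sets. *)
Lemma Skappa_convex_small t : Skappa k t -> convex_small t.
Proof.
move=> [g [tg tcl _ totp]] n I Icv It IC.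
have [->|/set0P[x0 Ix0]] := eqVneq I set0; first by rewrite setI0; apply: small0.
set C := Cset t _ in IC.
have Cn x : I x -> ~ C x by move=> Ix Cx; have : (I `&` C) x by []; rewrite IC.
have Cg x : C x -> x <= g.
  by move=> [v tv _]; apply: len_le tg tv.
have Ig x : I x -> x <= g by move=> /It; rewrite tg.
have Ccl : closed_in_succ g C by apply: tcl; lia.
have [l lE lP] := left_end Ccl (Ig _ Ix0) (Cn _ Ix0).
have [r rE rP] := right_end C x0.
(* [J] is the convex component of [x0] in the complement of [C] in [g + 1]. *)
pose J := succ g `&` [set` Interval l r].
have JP y : J y <-> [/\ y <= g, forall c, C c -> c < x0 -> c < y &
    forall c, C c -> x0 < c -> y < c].
  rewrite /J /= itv_boundlr; split=> [[yg /andP[/lP ? /rP ?]] //|[yg /lP ? /rP ?]].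
  by split=> //; apply/andP.
have Jopen : open_interval_of_succ g J.
  exists (Interval l r) => //.
  by case: lE rE => [->|[a ->]] [->|[b ->]].
have IJ : I `<=` J.
  move=> y Iy; apply/JP; split=> [|c Cc cx|c Cc xc]; first exact: Ig.
    rewrite ltNge; apply/negP => yc; apply: (Cn c) => //.
    by apply: (Icv y c x0) => //; apply: ltW.
  rewrite ltNge; apply/negP => cy; apply: (Cn c) => //.
  by apply: (Icv x0 c y) => //; apply: ltW.
apply: (@small_sub _ (Cset t n%:Z `&` J)); first by move=> x [Cx /IJ].
apply/otp_small/totp; split=> //.
  apply/seteqP; split=> // y [/JP[_ yl yr] Cy].
  have [lt|lt|e] := ltgtP y x0.
  - by have := yl y Cy lt; rewrite ltxx.
  - by have := yr y Cy lt; rewrite ltxx.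
  - by apply: (Cn y) => //; rewrite e.
move=> J' J'open J'C JJ'; apply/seteqP; split=> // y J'y.
have J'cv := open_interval_order_convex J'open.
have J'x : J' x0 by apply/JJ'/IJ.
have J'n c : C c -> ~ J' c by move=> Cc J'c; have : (J' `&` C) c by []; rewrite J'C.
apply/JP; split=> [|c Cc cx|c Cc xc].
- by case: J'open J'y => i _ -> [].
- rewrite ltNge; apply/negP => yc; apply: (J'n c) => //.
  by apply: (J'cv y c x0) => //; apply: ltW.
- rewrite ltNge; apply/negP => cy; apply: (J'n c) => //.
  by apply: (J'cv x0 c y) => //; apply: ltW.
Qed.

Definition liminf_at (t : oseq) (b : O) : Prop :=
  forall v : nat, t b = Some v -> unbounded_in (Cset t v%:Z) b /\
    forall n : int, unbounded_in (Cset t n) b -> (v%:Z <= n)%R.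

Lemma Skappa_liminf_at t b : Skappa k t -> is_limit b -> liminf_at t b.
Proof.
by move=> [g [tg _ tl _]] bl v tv; apply: tl => //; apply: len_le tg tv.
Qed.

(** Clause (a) follows from clause (b): if [Cset t n] is unbounded in a limit [b], minimality of
    [t b] gives [t b <= n]. *)
Lemma Skappa_of_liminf_at (t : oseq) (g : O) : len t = succ g ->
  (forall b, is_limit b -> liminf_at t b) -> convex_small t -> Skappa k t.
Proof.
move=> tg tl tc; exists g; split=> // [n _ b bg blim bun|b blim bg|n I [Iop IC _]].
- have : len t b by rewrite tg.
  rewrite /len /=; case tv : (t b) => [v|] // _; exists v => //.
  by have [_] := tl b blim v tv; apply.
- exact: tl.
- apply/small_otp/tc => //; first exact: open_interval_order_convex Iop.
  by rewrite tg; case: Iop => i _ -> x [].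
Qed.

Lemma unbounded_in_tail (C C' : set O) a b : a < b ->
  (forall y, a <= y -> y < b -> C y -> C' y) -> unbounded_in C b -> unbounded_in C' b.
Proof.
move=> ab CC' bun c cb; have [|x [Cx]] := bun (Order.max a c).
  by rewrite gt_max ab.
by rewrite ge_max => /andP[ax cx] xb; exists x; split=> //; apply: CC'.
Qed.

(** The value required at [b] depends only on a tail below [b] and moves along with a constant
    shift. The shift will be 0 on the part taken from [U] and 1 on the part taken from [s]. *)
Lemma liminf_at_shift (t t' : oseq) (m : nat) a b : a < b ->
  (forall y, a <= y -> y <= b -> t' y = omap (addn m) (t y)) ->
  liminf_at t b -> liminf_at t' b.
Proof.
move=> ab tt' tb v'; rewrite tt' ?(ltW ab) //; case tv : (t b) => [v|] //= [<-].
have [tu tm] := tb v tv; split=> [|n n_un].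
  apply: (unbounded_in_tail ab _ tu) => y ay yb [w tw wv].
  by exists (m + w)%N; [rewrite tt' ?tw // ltW|lia].
have : unbounded_in (Cset t (n - m%:Z)%R) b.
  apply: (unbounded_in_tail ab _ n_un) => y ay yb [w].
  by rewrite tt' ?(ltW yb) //; case ty : (t y) => [u|] //= [<-] un; exists u => //; lia.
by move/tm; lia.
Qed.

(** Adding 1 removes the zeros of [s], and the guard on predecessors admits only the first ordinal
    outside both domains. So beyond [U] the only zero is the last value. *)
Definition extend (U s : oseq) : oseq := fun x =>
  if U x is Some v then Some v else
  if s x is Some v then Some v.+1 else
  if `[< forall y, y < x -> U y <> None \/ s y <> None >] then Some 0%N else None.

Lemma extend_l (U s : oseq) x v : U x = Some v -> extend U s x = Some v.
Proof. by rewrite /extend => ->. Qed.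

Lemma not_limit_succ (a b : O) : is_succ a b -> ~ is_limit b.
Proof. by move=> ab [_ /(_ a)]; apply. Qed.

Lemma limit_gt (b : O) : is_limit b -> exists a, a < b.
Proof.
move=> [nz _]; apply: contrapT => na; apply: nz => x.
by rewrite leNgt; apply/negP => xb; apply: na; exists x.
Qed.

Lemma limit_gt_succ (a b : O) : is_limit b -> a < b -> exists2 c, a < c & c < b.
Proof.
move=> [_ ns] ab; apply: contrapT => nc; apply: (ns a); split=> // x xb.
by rewrite leNgt; apply/negP => ax; apply: nc; exists x.
Qed.

(** * Extending by Odd's move and a final zero stays in S_kappa *)

Section Extend.
Variables (U s : oseq) (e : O).
(** [U] stands for the union of Even's earlier sequences: each of its points lies in an initial
    segment that belongs to S_kappa and ends with 0. *)
Hypothesis U_zero : forall x, U x <> None -> exists t g,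
  [/\ Skappa k t, len t = succ g, t g = Some 0%N, x <= g & forall y, y <= g -> U y = t y].
Hypothesis s_case : s = empty_seq \/
  [/\ Skappa k s, U = empty_seq \/ exists g, len U = succ g & len U `<=` len s].
Hypothesis Ue : U e = None.
Hypothesis se : s e = None.
Hypothesis e_min : forall y, y < e -> U y <> None \/ s y <> None.

Lemma len_lt_U x : U x <> None -> x < e.
Proof.
move=> /U_zero[t [g [_ tg _ xg Ut]]]; rewrite ltNge; apply/negP => ex.
have : len t e by rewrite tg; apply: le_trans ex xg.
by apply; rewrite -Ut // (le_trans ex).
Qed.

Lemma len_lt_s x : s x <> None -> x < e.
Proof.
case: s_case => [->//|[[g [sg _ _ _]] _ _]] sx; rewrite ltNge; apply/negP => ex.
have xg : succ g x by rewrite -sg.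
have : len s e by rewrite sg; apply: le_trans ex xg.
by apply.
Qed.

Lemma extend_end : extend U s e = Some 0%N.
Proof. by rewrite /extend Ue se; case: asboolP. Qed.

Lemma len_extend : len (extend U s) = succ e.
Proof.
apply/seteqP; split=> x; rewrite /len /succ /= /extend.
  case Ux : (U x) => [v|]; first by move=> _; apply/ltW/len_lt_U; rewrite Ux.
  case sx : (s x) => [v|]; first by move=> _; apply/ltW/len_lt_s; rewrite sx.
  case: asboolP => // H _; rewrite leNgt; apply/negP => /H.
  by rewrite Ue se; case.
rewrite le_eqVlt => /orP[/eqP->|/e_min]; first by rewrite -/(extend U s e) extend_end.
by case: (U x) => [v|] //; case: (s x) => [v|] //; case.
Qed.

Lemma extend_liminf_at b : is_limit b -> liminf_at (extend U s) b.
Proof.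
move=> blim; have [be|eb|be] := ltgtP b e; last first.
(* At the end [e] the value 0 is right as soon as zeros are cofinal in [e]. Above a point of [U]
   there is the final zero of some [t]. *)
- rewrite be in blim *; move=> v0; rewrite extend_end => -[<-]; split=> [a ae|n n_un]; last first.
    have [a ae] := limit_gt blim.
    by have [x [[v _ vn] _ _]] := n_un a ae; lia.
  have [Ua|/contrapT Ua] := pselect (U a <> None).
    have [t [g [_ tg t0 ag Ut]]] := U_zero Ua.
    have Ug : U g = Some 0%N by rewrite Ut.
    exists g; split=> //; first by exists 0%N => //; rewrite (extend_l _ Ug).
    by apply: len_lt_U; rewrite Ug.
  case: s_case => [s0|[[g [sg _ _ _]] _ Us]]; first by case: (e_min ae); rewrite ?Ua ?s0.
  (* Some [a < e] is outside [U], so [s] is nonempty and covers everything below [e]. Then [e] is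
     the successor of the last point of [s], hence no limit. *)
  case: (@not_limit_succ g e) => //; split=> [|x xe].
    by apply: len_lt_s; have : len s g by rewrite sg /succ /=.
  suff : succ g x by [].
  by rewrite -sg; case: (e_min xe) => // /Us.
- move=> v bv; have := len_le len_extend bv.
  by rewrite leNgt eb.
case Ub : (U b) => [v|].
  have [|t [g [tS tg t0 bg Ut]]] := U_zero (x := b); first by rewrite Ub.
  have [a ab] := limit_gt blim.
  apply: (liminf_at_shift (t := t) (m := 0%N) ab _ (Skappa_liminf_at tS blim)) => y _ yb.
  have yg := le_trans yb bg.
  have : len t y by rewrite tg.
  rewrite /len /= /extend Ut //; case: (t y) => //.
case: s_case => [s0|[sS Ug Us]].
  by case: (e_min be); rewrite ?Ub ?s0.
(* The domain of [U] is empty or a successor, so a limit [b] outside it has a whole tail outside it,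
   where the sequence is [s + 1]. *)
have [a ab Ua] : exists2 a, a < b & forall y, a <= y -> U y = None.
  case: Ug => [->|[g Ug]]; first by have [a] := limit_gt blim; exists a.
  have gb : g < b.
    rewrite ltNge; apply/negP => bg; have : len U b by rewrite Ug.
    by rewrite /len /= Ub.
  have [a ga ab] := limit_gt_succ blim gb; exists a => // y ay.
  case Uy : (U y) => [v|] //; have := len_le Ug Uy.
  by rewrite leNgt (lt_le_trans ga).
apply: (liminf_at_shift (t := s) (m := 1%N) ab _ (Skappa_liminf_at sS blim)) => y ay yb.
have ye := le_lt_trans yb be.
have Uy := Ua y ay.
by rewrite /extend Uy; case: (e_min ye); rewrite ?Uy //; case: (s y).
Qed.

Lemma extend_convex_small : small (Cset (extend U s) 0) -> convex_small (extend U s).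
Proof.
move=> sz [|n] I Icv IE IC; first by apply: small_sub sz => x [].
have nz x : I x -> extend U s x <> Some 0%N.
  move=> Ix Ex; have : (I `&` Cset (extend U s) (n.+1%:Z - 1)%R) x.
    by split=> //; exists 0%N => //; lia.
  by rewrite IC.
(* If [I] meets the domain of [U], the zero of [t] at [g] cannot lie in the convex set [I], so [I]
   stays below [g] and clause (c) comes from [t]. *)
have [[x [Ix Ux]]|nx] := pselect (exists x, I x /\ U x <> None).
  have [t [g [tS tg t0 xg Ut]]] := U_zero Ux.
  have Ig y : I y -> y < g.
    move=> Iy; rewrite ltNge; apply/negP => gy; apply: (nz g).
      exact: (Icv x g y).
    by rewrite (@extend_l _ _ _ 0%N) // Ut.
  have It : I `<=` len t by move=> y /Ig/ltW; rewrite tg.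
  have tE y : I y -> t y = extend U s y.
    move=> /[dup] /It + /Ig/ltW yg; rewrite /len /= /extend Ut //.
    by case: (t y).
  apply: small_sub (Skappa_convex_small tS (n := n.+1) Icv It _).
    by move=> y [[v Ev vn] Iy]; split=> //; exists v => //; rewrite tE.
  apply/seteqP; split=> // y [Iy [v tv vn]].
  by rewrite -IC; split=> //; exists v => //; rewrite -tE.
(* Otherwise [I] lies in the part taken from [s], where values at most [n + 1] come from values of
   [s] at most [n]: clause (c) of [s] one level down applies. *)
have sE y : I y -> extend U s y = omap (addn 1) (s y) /\ s y <> None.
  move=> Iy; have Uy : U y = None.
    by case Uy : (U y) => [v|] //; case: nx; exists y; rewrite Uy.
  have := IE _ Iy; have := nz _ Iy; rewrite /len /= /extend Uy.
  by case: (s y) => //; case: ifP.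
case: s_case => [s0|[sS _ _]].
  apply: small_sub small0 => y [_ /sE[_]].
  by rewrite s0.
apply: small_sub (Skappa_convex_small sS (n := n) Icv _ _).
- move=> y [[v Ev vn] Iy]; split=> //; have [] := sE _ Iy.
  rewrite Ev; case sy : (s y) => [w|] //= [vw] _; exists w => //.
  by move: vn; rewrite vw; lia.
- by move=> y /sE[].
- apply/seteqP; split=> // y [Iy [v sv vn]]; rewrite -IC; split=> //.
  have [+ _] := sE _ Iy; rewrite sv /= => Ey; exists (1 + v)%N => //.
  lia.
Qed.

Lemma extend_Skappa : small (Cset (extend U s) 0) -> Skappa k (extend U s).
Proof.
move=> sz; apply: (Skappa_of_liminf_at len_extend extend_liminf_at).
exact: extend_convex_small.
Qed.

End Extend.

End Sequences.

(** * Equivalence classes of sequences *)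

Section Classes.
Context {d : Order.disp_t} {O : orderType d}.
Local Notation oseq := (@oseq d O).
Implicit Types (s t r : oseq) (m : O -> int).

Lemma modifier_comp2 (h : int -> int -> int) m1 m2 : modifier m1 -> modifier m2 ->
  modifier (fun x => h (m1 x) (m2 x)).
Proof.
move=> [c1 [e1 E1]] [c2 [e2 E2]]; split=> [b bl|].
  have [a1 ab1 A1] := c1 b bl; have [a2 ab2 A2] := c2 b bl.
  exists (Order.max a1 a2); first by rewrite gt_max ab1.
  by move=> x; rewrite ge_max => /andP[x1 x2] xb; rewrite A1 // A2.
exists (Order.max e1 e2) => x; rewrite ge_max => /andP[x1 x2].
by rewrite E1 // E2 // E1 ?le_max ?lexx // E2 // le_max lexx orbT.
Qed.

Lemma modifier_cst (O_point : O) (z : int) : modifier (fun _ : O => z).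
Proof.
split=> [b bl|]; last by exists O_point.
by have [a ab] := limit_gt bl; exists a.
Qed.

(** The jump after [g] does not harm continuity, since a limit above [g] has a tail above [g]. This
    is what lets Even shift the new part of Odd's sequence. *)
Lemma modifier_cut (g g' : O) m (z : int) : g < g' -> modifier m ->
  modifier (fun x => if x <= g then m x else z).
Proof.
move=> gg' [c _]; split=> [b bl|]; last first.
  exists g' => x g'x; rewrite !leNgt gg' /=.
  by rewrite (lt_le_trans gg').
have [bg|gb] := leP b g.
  have [a ab A] := c b bl; exists a => // x ax xb.
  by rewrite (le_trans xb bg) A.
have [a ga ab] := limit_gt_succ bl gb; exists a => // x ax _.
by rewrite leNgt (lt_le_trans ga ax).
Qed.

(** Legality of [m] is automatic, because the values of [t] are natural numbers. *)
Lemma class_ofP s t : class_of s t <->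
  exists2 m, modifier m & forall x, omap Posz (t x) = add_modifier s m x.
Proof.
split=> [[m [mm _ e]]|[m mm e]].
  by exists m => // x; rewrite -e.
exists m; split=> //; last exact/funext.
by move=> b z; rewrite -e; case: (t b) => // v [<-].
Qed.

Lemma class_of_refl (O_point : O) s : class_of s s.
Proof.
apply/class_ofP; exists (fun=> 0%R); first exact: modifier_cst.
by move=> x; rewrite /add_modifier; case: (s x) => //= v; rewrite GRing.addr0.
Qed.

(** Modifiers can be added and subtracted, so the relation is transitive and symmetric. *)
Lemma class_of_eq s t : class_of s t -> class_of t = class_of s.
Proof.
move=> /class_ofP[m mm e]; apply/seteqP; split=> r /class_ofP[m' mm' e']; apply/class_ofP.
  exists (fun x => m x + m' x)%R; first exact: (modifier_comp2 _ mm mm').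
  move=> x; rewrite e' /add_modifier; have := e x; rewrite /add_modifier.
  by case: (t x) => [v|]; case: (s x) => [w|] //= -[->]; rewrite GRing.addrA.
exists (fun x => m' x - m x)%R; first exact: (modifier_comp2 (fun x y => x - y)%R mm' mm).
move=> x; rewrite e' /add_modifier; have := e x; rewrite /add_modifier.
by case: (t x) => [v|]; case: (s x) => [w|] //= -[->]; congr Some; lia.
Qed.

Lemma class_of_len s t : class_of s t -> len t = len s.
Proof.
move=> /class_ofP[m _ e]; apply/seteqP; split=> x; have := e x;
by rewrite /len /= /add_modifier; case: (t x); case: (s x).
Qed.

End Classes.

(** * Even's strategy *)

Section Strategy.
Context {d : Order.disp_t} {O : orderType d}.
Hypothesis wo : well_ordered (O := O).
Variable k : O.
Hypothesis k_infinite : infinite_set (below k).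
Hypothesis O_succ : order_type_is_succ_cardinal k.
Local Notation oseq := (@oseq d O).
Local Notation P := (Pkappa k).

Definition rep (c : P) : oseq := s2val (cid2 (proj2_sig c)).

Lemma repP (c : P) : representative k (rep c) /\ sval c = class_of (rep c).
Proof. by rewrite /rep; case: cid2. Qed.

Definition condition (t : oseq) : P :=
  if pselect (representative k t) is left H
  then exist _ (class_of t) (ex_intro2 _ _ t H erefl) else Pkappa_one k.

Lemma sval_condition t : representative k t -> sval (condition t) = class_of t.
Proof. by move=> H; rewrite /condition; case: pselect. Qed.

Lemma condition_empty : condition empty_seq = Pkappa_one k.
Proof.
rewrite /condition; case: pselect => // H; congr exist; exact: Prop_irrelevance.
Qed.

Definition last_move (p : O -> P) (b : O) : oseq :=
  if pselect (exists a, is_succ a b) is left H then rep (p (sval (cid H))) else empty_seq.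

(** The choice made by [xget] is unambiguous once the sequences extend one another, as in
    [union_evenP]. *)
Definition union_even (b : O) (h : forall g : O, g < b -> oseq) : oseq := fun x =>
  xget None [set y | y <> None /\ exists g (lt : g < b), even_stage g /\ h g lt x = y].

(** A move is only a class and does not remember Even's representative, which is therefore
    recomputed from the play by recursion on the stage. *)
Definition answer (p : O -> P) : O -> oseq := Fix (wo_wf wo) (fun=> oseq)
  (fun b h => if pselect (is_zero b) then empty_seq
              else extend (union_even h) (last_move p b)).

Lemma answerE p b : answer p b = if pselect (is_zero b) then empty_seq
  else extend (union_even (b := b) (fun g _ => answer p g)) (last_move p b).
Proof.
rewrite [LHS]/answer Fix_eq; first by [].
move=> x f h fh; case: (pselect (is_zero x)) => //= nz.
congr (extend (union_even _) _).
by apply: functional_extensionality_dep => z; apply: functional_extensionality_dep.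
Qed.

Lemma eq_answer p q b : (forall g, g < b -> p g = q g) -> answer p b = answer q b.
Proof.
elim/(wo_ind wo): b => b IH pq; rewrite !answerE; case: pselect => //= nz.
congr extend; last first.
  rewrite /last_move; case: pselect => // H; rewrite pq //.
  by case: (cid H) => a [].
congr union_even; apply: functional_extensionality_dep => g.
apply: functional_extensionality_dep => gb; apply: IH => // x xg.
by apply: pq; apply: lt_trans gb.
Qed.

(** Moves from [b] on are filled in with 1; by [eq_answer] they do not affect the answer at [b]. *)
Definition even_strategy : strategy (O := O) (P := P) := fun b h =>
  condition (answer (fun x => if pselect (x < b) is left H then h (exist _ x H)
                              else Pkappa_one k) b).

Lemma is_succ_inj (a a' b : O) : is_succ a b -> is_succ a' b -> a = a'.
Proof. by move=> [ab sa] [ab' sa']; apply: le_anti; rewrite sa' // sa. Qed.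

Lemma stage_parity (b : O) : even_stage b \/ odd_stage b.
Proof.
elim/(wo_ind wo): b => b IH.
have [bz|bz] := pselect (is_zero b); first by left; apply: even_zero.
have [[a ab]|na] := pselect (exists a, is_succ a b); last first.
  by left; apply: even_limit; split=> // a ab; apply: na; exists a.
by have [ae|ao] := IH a ab.1; [right; apply: odd_succ ab ae|left; apply: even_succ ab ao].
Qed.

Lemma even_not_odd (b : O) : even_stage b -> ~ odd_stage b.
Proof.
elim/(wo_ind wo): b => b IH be bo; case: bo be IH => a {}b ab ae be.
case: be ab => [{}b bz [ab _]|{}b [_ /(_ a)] //|a' {}b ab' ao' ab] IH.
  by have := bz a; rewrite leNgt ab.
by apply: (IH a) => //; [case: ab|rewrite (is_succ_inj ab ab')].
Qed.

Lemma even_pred (a b : O) : even_stage b -> ~ is_zero b -> is_succ a b -> odd_stage a.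
Proof.
case=> [{}b bz /(_ bz) //|{}b bl _ /not_limit_succ/(_ bl) //|a' {}b ab' ao _ ab].
by rewrite (is_succ_inj ab ab').
Qed.

Lemma odd_pred (b : O) : odd_stage b -> exists2 a, is_succ a b & even_stage a.
Proof. by case=> a {}b; exists a. Qed.

Lemma no_max (g : O) : exists g', g < g'.
Proof.
have [y yP] := bounded_of_succ_cardinal wo (fun=> g) k_infinite O_succ.
by have [x xk] := infinite_setN0 k_infinite; exists y; apply: (yP x).
Qed.

Section Play.
Variable p : O -> P.
Hypothesis p_follows : forall b, b <= k -> even_stage b -> p b = condition (answer p b).
Local Notation T := (answer p).

(** This is the inequality between [p b] and [p g], with [T b] as the representative of the stronger
    condition. *)
Definition decides (b g : O) : Prop := exists s : oseq,
  [/\ representative k s, sval (p g) = class_of s, len s `<=` len (T b) &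
      class_of s = class_of (restrict (T b) (len s))].

(** The third clause bounds the number of zeros of [T b] by that of the even stages up to [b], for
    clause (c) at level 0. The fourth makes Even's move acceptable. *)
Definition play_invariant (b : O) : Prop :=
  [/\ (is_zero b /\ T b = empty_seq) \/
      (Skappa k (T b) /\ exists g, len (T b) = succ g /\ T b g = Some 0%N),
      forall c, c < b -> even_stage c -> forall x v, T c x = Some v -> T b x = Some v,
      forall x, T b x = Some 0%N -> exists c, [/\ even_stage c, c <= b & len (T c) = succ x] &
      forall g, g < b -> decides b g].

Lemma invariant_representative b : play_invariant b -> representative k (T b).
Proof. by case=> -[[_ ->]|[bS _]] *; [right|left]. Qed.

Lemma invariant_sval b : b <= k -> even_stage b -> play_invariant b ->
  sval (p b) = class_of (T b).
Proof. by move=> bk be /invariant_representative r; rewrite p_follows // sval_condition. Qed.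

(** The order only provides some representatives [t] and [s]. The modifiers from [rep (p a)] to [t]
    and from the restricted [t] to [T c] add up to one relating the chosen representatives. *)
Lemma odd_extends a c : c <= k -> even_stage c -> play_invariant c ->
  Pkappa_le (p a) (p c) -> len (T c) `<=` len (rep (p a)) /\
  exists2 m, modifier m & forall x, len (T c) x ->
    omap Posz (T c x) = add_modifier (rep (p a)) m x.
Proof.
move=> ck ce cI [t [s [[_ pt] [_ ps] st cst]]]; set r := rep (p a).
have tr : class_of r t by rewrite -(repP (p a)).2 pt; apply: class_of_refl.
have Tr : class_of (restrict t (len s)) (T c).
  by rewrite -cst -ps invariant_sval //; apply: class_of_refl.
have sT : len s = len (T c).
  rewrite (class_of_len Tr); apply/seteqP; split=> x; rewrite /len /restrict /=.
    by move=> sx; case: asboolP => // _; apply: st.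
  by case: asboolP.
split; first by rewrite -(class_of_len tr) -sT.
move: tr Tr => /class_ofP[m mm tm] /class_ofP[m' mm' Tm].
exists (fun x => m x + m' x)%R; first exact: (modifier_comp2 _ mm mm').
move=> x Tx; rewrite Tm /add_modifier /restrict; case: asboolP; last by rewrite sT.
move=> _; have := tm x; rewrite /add_modifier.
by case: (t x) => [v|]; case: (r x) => [w|] //= -[->]; rewrite GRing.addrA.
Qed.

Lemma decides_even b g : g <= k -> even_stage g -> play_invariant g ->
  (forall x v, T g x = Some v -> T b x = Some v) -> decides b g.
Proof.
move=> gk ge gI gb; exists (T g); split.
- exact: invariant_representative.
- exact: invariant_sval.
- move=> x; rewrite /len /=; case gx : (T g x) => [v|] // _.
  by rewrite (gb _ _ gx).
- congr class_of; apply/funext => x; rewrite /restrict; case: asboolP.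
    by rewrite /len /=; case gx : (T g x) => [v|] // _; rewrite (gb _ _ gx).
  by move=> /contrapT.
Qed.

Lemma decides_trans b h g : (forall x v, T h x = Some v -> T b x = Some v) ->
  decides h g -> decides b g.
Proof.
move=> hb [s [sr ps sh cs]]; exists s.
have hbE x : len (T h) x -> T b x = T h x.
  by rewrite /len /=; case hx : (T h x) => [v|] // _; apply: hb.
split=> // [x /sh hx|]; first by rewrite /len /= hbE.
rewrite cs; congr class_of; apply/funext => x; rewrite /restrict.
by case: asboolP => // /sh hx; rewrite hbE.
Qed.

Lemma invariant_top b x : play_invariant b -> T b x <> None ->
  exists g, [/\ Skappa k (T b), len (T b) = succ g, T b g = Some 0%N & x <= g].
Proof.
move=> [[[_ ->] //|[bS [g [bg b0]]]] _ _ _] bx; exists g; split=> //.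
suff : succ g x by []. by rewrite -bg.
Qed.

(** * The induction step at a nonzero even stage *)

Section Step.
Variable b : O.
Hypothesis bk : b <= k.
Hypothesis b_even : even_stage b.
Hypothesis b_nonzero : ~ is_zero b.
Hypothesis IH : forall c, c < b -> even_stage c -> play_invariant c.
Hypothesis acceptable : forall g, g < b ->
  acceptable_move (@Pkappa_le d O k) (Pkappa_one k) p g.

Let U : oseq := union_even (b := b) (fun g _ => T g).
Let s : oseq := last_move p b.

Lemma answer_extend : T b = extend U s.
Proof. by rewrite answerE; case: pselect. Qed.

Lemma union_evenP x v : U x = Some v <-> exists c, [/\ c < b, even_stage c & T c x = Some v].
Proof.
have mono c c' : c < b -> even_stage c -> c' <= c -> even_stage c' ->
    forall y w, T c' y = Some w -> T c y = Some w.
  move=> cb ce; rewrite le_eqVlt => /orP[/eqP->//|c'c c'e].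
  by have [_ + _ _] := IH cb ce; apply.
split.
  rewrite /U /union_even; case: xgetP => // _ -> [_ [c [cb [ce <-]]]] cx.
  by exists c.
move=> [c [cb ce cx]]; apply: xget_unique => [|y [y0 [c' [c'b [c'e c'x]]]]].
  by split=> //; exists c, cb.
case: y y0 c'x => // w _ c'x; have [cc'|c'c] := leP c c'.
  by rewrite -c'x; apply: (mono c' c).
by rewrite -cx; apply/esym/(mono c c') => //; apply: ltW.
Qed.

Lemma union_even_zero x : U x <> None -> exists t g,
  [/\ Skappa k t, len t = succ g, t g = Some 0%N, x <= g & forall y, y <= g -> U y = t y].
Proof.
case Ux : (U x) => [v|] // _; have [c [cb ce cx]] := (union_evenP x v).1 Ux.
have [|g [cS cg c0 xg]] := invariant_top (x := x) (IH cb ce); first by rewrite cx.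
exists (T c), g; split=> // y yg; have : len (T c) y by rewrite cg.
by rewrite /len /=; case cy : (T c y) => [w|] // _; apply/union_evenP; exists c.
Qed.

(** A nonzero even successor is [c + 2] with [c] even. The earlier even stages are then at most [c],
    so their union is already [T c]. *)
Lemma step_cases : (is_limit b /\ s = empty_seq) \/
  exists a c, [/\ is_succ a b, is_succ c a, even_stage c, s = rep (p a) & U = T c].
Proof.
have [[a ab]|na] := pselect (exists a, is_succ a b); last first.
  left; split; last by rewrite /s /last_move; case: pselect.
  by split=> // a ab; apply: na; exists a.
right; have [c ca ce] := odd_pred (even_pred b_even b_nonzero ab).
exists a, c; split=> //.
  rewrite /s /last_move; case: pselect => [H|[]]; last by exists a.
  by rewrite (is_succ_inj (svalP (cid H)) ab).
apply/funext => x.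
have cb : c < b by apply: lt_trans ca.1 ab.1.
case cx : (T c x) => [v|]; first by apply/union_evenP; exists c.
case Ux : (U x) => [v|] //; have [c' [c'b c'e c'x]] := (union_evenP x v).1 Ux.
have : c' <= c.
  apply: ca.2; rewrite lt_neqAle ab.2 // andbT; apply/eqP => c'a.
  by apply: (even_not_odd c'e); rewrite c'a; apply: odd_succ ca ce.
rewrite le_eqVlt => /orP[/eqP e|lt]; first by rewrite -e c'x in cx.
by have [_ /(_ c' lt c'e x v c'x) + _ _] := IH cb ce; rewrite cx.
Qed.

Lemma odd_step a c : is_succ a b -> is_succ c a -> even_stage c ->
  len (T c) `<=` len (rep (p a)) /\
  exists2 m, modifier m & forall x, len (T c) x ->
    omap Posz (T c x) = add_modifier (rep (p a)) m x.
Proof.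
move=> ab ca ce; have cb := lt_trans ca.1 ab.1.
apply: odd_extends => //; first exact: le_trans (ltW cb) bk.
  exact: IH.
by have [+ _] := acceptable ab.1; apply; case: ca.
Qed.

Lemma step_s_case : s = empty_seq \/
  [/\ Skappa k s, U = empty_seq \/ exists g, len U = succ g & len U `<=` len s].
Proof.
have [[_ s0]|[a [c [ab ca ce sE UE]]]] := step_cases; first by left.
have [[sS|s0] _] := repP (p a); last by left; rewrite sE.
right; rewrite sE UE; split=> //; last by case: (odd_step ab ca ce).
have [[[_ ->]|[_ [g [-> _]]]] _ _ _] := IH (lt_trans ca.1 ab.1) ce; first by left.
by right; exists g.
Qed.

(** By regularity the top points of the [T c] with [c < b <= k] are bounded in kappa^+, and so is
    the domain of [s]. The new end [e] is the least ordinal outside both domains. *)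
Lemma step_end : exists e, [/\ U e = None, s e = None &
  forall y, y < e -> U y <> None \/ s y <> None].
Proof.
have /choice[f fP] c : exists g, forall h, len (T c) = succ h -> g = h.
  have [[g cg]|ng] := pselect (exists g, len (T c) = succ g); last first.
    by exists k => h ch; case: ng; exists h.
  exists g => h; rewrite cg => gh; apply: le_anti.
  have gg : succ g g by rewrite /succ /=.
  have hh : succ h h by rewrite /succ /=.
  by rewrite gh in gg; rewrite -gh in hh; apply/andP.
have [y yP] := bounded_of_succ_cardinal wo f k_infinite O_succ.
have Uy z : y <= z -> U z = None.
  move=> yz; case Uz : (U z) => [v|] //.
  have [c [cb ce cz]] := (union_evenP z v).1 Uz.
  have [|g [_ cg _ zg]] := invariant_top (x := z) (IH cb ce); first by rewrite cz.
  have := yP c (lt_le_trans cb bk); rewrite (fP c g) // => gy.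
  by have := lt_le_trans gy (le_trans yz zg); rewrite ltxx.
have [z sz] : exists z, forall w, z <= w -> s w = None.
  case: step_s_case => [->|[[g [sg _ _ _]] _ _]]; first by exists y.
  have [z gz] := no_max g; exists z => w zw; case sw : (s w) => [v|] //.
  by have := len_le sg sw; rewrite leNgt (lt_le_trans gz).
have [|e [Ue se] emin] := wo_min wo (A := [set x | U x = None /\ s x = None]).
  exists (Order.max y z); split; [apply: Uy|apply: sz];
  by rewrite le_max lexx ?orbT.
exists e; split=> // x xe; apply: contrapT => /not_orP[/contrapT Ux /contrapT sx].
by have := emin x (conj Ux sx); rewrite leNgt xe.
Qed.

Lemma step_extends c : c < b -> even_stage c -> forall x v, T c x = Some v -> T b x = Some v.
Proof.
move=> cb ce x v cx; rewrite answer_extend; apply: extend_l.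
by apply/union_evenP; exists c.
Qed.

Lemma step_zeros e : len (T b) = succ e -> U e = None -> s e = None ->
  (forall y, y < e -> U y <> None \/ s y <> None) ->
  forall x, T b x = Some 0%N -> exists c, [/\ even_stage c, c <= b & len (T c) = succ x].
Proof.
move=> be Ue se emin x bx; have := bx; rewrite answer_extend /extend.
case Ux : (U x) => [v|].
  move=> [v0]; have [c [cb ce cx]] := (union_evenP x v).1 Ux.
  have [_ _ cz _] := IH cb ce; have [|c' [c'e c'c c'x]] := cz x; first by rewrite cx v0.
  by exists c'; split=> //; apply: le_trans c'c (ltW cb).
case sx : (s x) => [v|] //; case: asboolP => // H _.
suff -> : x = e by exists b.
have := len_le be bx; rewrite le_eqVlt => /orP[/eqP //|/emin].
by rewrite Ux sx; case.
Qed.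

Lemma step_small :
  (forall x, T b x = Some 0%N -> exists c, [/\ even_stage c, c <= b & len (T c) = succ x]) ->
  small k (Cset (T b) 0).
Proof.
move=> zeros; have [z zk] := infinite_setN0 k_infinite.
have /choice[h hP] x : exists c, T b x = Some 0%N ->
    [/\ even_stage c, c <= b & len (T c) = succ x].
  by have [/zeros[c]|nx] := pselect (T b x = Some 0%N); [exists c|exists b].
have Cz x : Cset (T b) 0 x -> T b x = Some 0%N.
  by move=> [v -> v0]; congr Some; lia.
have hI x x' : T b x = Some 0%N -> T b x' = Some 0%N -> x < x' -> h x < h x'.
  move=> /hP[he hb hx] /hP[he' hb' hx'] xx'; rewrite ltNge; apply/negP => le.
  have : succ x x'.
    rewrite -hx; have : len (T (h x')) x' by rewrite hx' /succ /=.
    move: le; rewrite le_eqVlt => /orP[/eqP->//|lt].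
    rewrite /len /=; case h'x : (T (h x') x') => [v|] // _.
    suff -> : T (h x) x' = Some v by [].
    move: hb; rewrite le_eqVlt => /orP[/eqP e|hb].
      by rewrite e; apply: step_extends h'x => //; rewrite -e.
    by have [_ + _ _] := IH hb he; apply; eassumption.
  by rewrite /succ /= leNgt xx'.
(* [h] sends a zero to a stage whose sequence ends there, and it is strictly increasing. Only the
   greatest zero can have stage [k]; it goes to the second copy of [k]. *)
exists 1%N, (fun x => if h x < k then (0%N, h x) else (1%N, z)); split.
  by move=> x _; case: ifP.
move=> x x' /Cz bx /Cz bx' xx'; have hh := hI _ _ bx bx' xx'.
have [_ hb' _] := hP _ bx'.
rewrite (lt_le_trans hh (le_trans hb' bk)).
by case: ifP => _; rewrite ltEprodlexi /= ?hh.
Qed.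

Lemma step_decides g : g < b -> decides b g.
Proof.
move=> gb; have [ge|go] := stage_parity g.
  have gk := ltW (lt_le_trans gb bk).
  by apply: decides_even => //; [apply: IH|move=> x v; apply: step_extends].
have [[h [he gh hb]]|nh] := pselect (exists h, [/\ even_stage h, g < h & h < b]).
  apply: (decides_trans (h := h)); first exact: step_extends.
  by have [_ _ _] := IH hb he; apply.
(* For a limit [b], the successor of the odd stage [g] would be an even stage strictly between [g]
   and [b]. *)
have [[bl _]|[a [c [ab ca ce sE UE]]]] := step_cases.
  have [c gc cb] := limit_gt_succ bl gb.
  have [|h gh hmin] := wo_min wo (A := [set h | g < h]); first by exists c.
  case: nh; exists h; split=> //; last exact: le_lt_trans (hmin c gc) cb.
  apply: even_succ go; split=> // x xh; rewrite leNgt; apply/negP => gx.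
  by have := hmin x gx; rewrite leNgt xh.
have ga : g = a.
  apply: le_anti; rewrite ab.2 //= leNgt; apply/negP => ga.
  have := ca.2 g ga; rewrite le_eqVlt => /orP[/eqP gc|gc].
    by apply: (even_not_odd ce); rewrite -gc.
  by case: nh; exists c; split=> //; apply: lt_trans ca.1 ab.1.
have [cs [m mm Tm]] := odd_step ab ca ce; have [sr ps] := repP (p a).
rewrite ga; exists (rep (p a)); split=> //.
  move=> x; rewrite answer_extend sE /len /= /extend.
  by case: (U x) => // ; case: (rep (p a) x).
apply/esym/class_of_eq/class_ofP.
(* [m] turns Odd's sequence into [T c] on the domain of [T c]; above it, [extend] has added 1. *)
exists (fun x => if T c x is Some _ then m x else 1%R).
  have [[[_ ->]|[_ [h [ch _]]]] _ _ _] := IH (lt_trans ca.1 ab.1) ce.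
    exact: modifier_cst.
  have [h' hh'] := no_max h; have := modifier_cut 1%R hh' mm.
  congr modifier; apply/funext => x.
  have : len (T c) x <-> x <= h by rewrite ch.
  rewrite /len /=; case: (T c x) => [v|] [cx hx]; first by rewrite cx.
  by case: ifP => // /hx.
move=> x; rewrite /restrict; case: asboolP => [|sx]; last first.
  by rewrite /add_modifier; move/contrapT: sx => ->.
have := Tm x; rewrite answer_extend UE sE /extend /add_modifier /len /=.
case: (T c x) => [v|]; first by move=> ->.
by case: (rep (p a) x) => [v|] //= _ _; congr Some; lia.
Qed.

Lemma play_invariant_step : play_invariant b.
Proof.
have [e [Ue se emin]] := step_end.
have be : len (T b) = succ e.
  by rewrite answer_extend; apply: len_extend union_even_zero step_s_case Ue se emin.
have zeros := step_zeros be Ue se emin.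
have sz := step_small zeros; split=> //; [right|exact: step_extends|exact: step_decides].
split.
  rewrite answer_extend in sz *.
  exact: (extend_Skappa wo k_infinite union_even_zero step_s_case Ue se emin).
by exists e; split=> //; rewrite answer_extend (extend_end Ue se emin).
Qed.

End Step.

Lemma play_invariantP b : b <= k -> even_stage b ->
  (forall g, g < b -> acceptable_move (@Pkappa_le d O k) (Pkappa_one k) p g) ->
  play_invariant b.
Proof.
elim/(wo_ind wo): b => b IH bk be acc.
have IH' c : c < b -> even_stage c -> play_invariant c.
  move=> cb ce; apply: IH => //; first exact: le_trans (ltW cb) bk.
  by move=> g gc; apply: acc; apply: lt_trans cb.
have [bz|bz] := pselect (is_zero b); last exact: play_invariant_step.
have b0 : T b = empty_seq by rewrite answerE; case: pselect.
split; [by left| | |].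
- by move=> c; rewrite ltNge bz.
- by move=> x; rewrite b0.
- by move=> c; rewrite ltNge bz.
Qed.

End Play.

Lemma even_strategy_wins p : follows (succ k) even_strategy p ->
  Even_wins (@Pkappa_le d O k) (Pkappa_one k) (succ k) p.
Proof.
move=> fol.
have pE b : b <= k -> even_stage b -> p b = condition (answer p b).
  move=> bk be; rewrite (fol b bk be) /even_strategy; congr condition.
  by apply: eq_answer => g gb; case: pselect.
(* A loss at [b] presupposes that all earlier moves, Odd's included, were acceptable; the invariant
   at [b] rests on this. *)
move=> b bk be [acc]; apply.
have bI := play_invariantP pE bk be acc.
have [bz _ _ dec] := bI; split=> [g gb|b0].
  have [s [sr ps sb cs]] := dec g gb.
  exists (answer p b), s; split=> //; split; first exact: (invariant_representative bI).
  exact: (invariant_sval pE bk be bI).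
case: bz => [[_ Tb]|[_ [g [Tg T0]]]]; first by rewrite pE // Tb condition_empty.
move: T0; rewrite answerE; case: pselect => //=.
Qed.

End Strategy.

Theorem theorem6p3 (d : Order.disp_t) (O : orderType d)
    (O_well_ordered : well_ordered (O := O)) (kappa : O)
    (kappa_infinite_cardinal : infinite_cardinal kappa)
    (O_is_kappa_plus : order_type_is_succ_cardinal kappa) :
  strategically_closed (@Pkappa_le d O kappa) (Pkappa_one kappa) (succ kappa).
Proof.
exists (even_strategy O_well_ordered (k := kappa)) => p.
case: kappa_infinite_cardinal => kappa_infinite _.
exact: (even_strategy_wins kappa_infinite O_is_kappa_plus).
Qed.
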